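(* Fix a positive integer $k$. Suppose that every $k$-tuple of tree degree sequences without common leaves on at most $4k-2$ vertices has edge disjoint tree realizations. Then every $k$-tuple of tree degree sequences without common leaves (on any number of vertices) has edge disjoint tree realizations.
   Context: A tree degree sequence on $n$ vertices is a list of positive integers $d_1,\dots,d_n$ with $\sum_i d_i=2n-2$. For tree degree sequences $D_1,\dots,D_k$ on a common vertex set, $d_v^{(i)}$ denotes the entry of vertex $v$ in $D_i$; they have no common leaves if for every vertex $v$ and index $i$, $d_v^{(i)}=1$ implies $d_v^{(j)}>1$ for all $j\ne i$. Edge disjoint tree realizations are pairwise edge-disjoint trees $T_1,\dots,T_k$ on the vertex set with each $T_i$ having degree sequence $D_i$. *)

(* Defs.v *)
From mathcomp Require Import all_boot.
Set Implicit Arguments.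
Unset Strict Implicit.
Unset Printing Implicit Defensive.

(* The sum condition [\sum d = 2 n - 2] is written without the truncated
   subtraction of [nat], which would wrongly accept the empty list ([n = 0]). *)
Definition tree_degseq (n : nat) (d : 'I_n -> nat) : Prop :=
  (forall v, 0 < d v) /\ (\sum_(v < n) d v) + 2 = 2 * n.

Definition no_common_leaves (k n : nat) (D : 'I_k -> 'I_n -> nat) : Prop :=
  forall (v : 'I_n) (i j : 'I_k), D i v = 1 -> j != i -> 1 < D j v.

Section Graph.

Variable V : finType.

Definition simple_graph (e : rel V) : Prop := symmetric e /\ irreflexive e.

Definition connected_graph (e : rel V) : Prop :=
  0 < #|V| /\ forall x y : V, connect e x y.

(* [ucycle e c]: the vertices of [c] are distinct and cyclically consecutive
   ones are adjacent. Since a single edge [x y] yields [ucycle e [:: x; y]],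
   genuine cycles are those of length at least 3. *)
Definition acyclic_graph (e : rel V) : Prop :=
  forall c : seq V, 2 < size c -> ~ ucycle e c.

Definition is_tree (e : rel V) : Prop :=
  [/\ simple_graph e, connected_graph e & acyclic_graph e].

Definition degree (e : rel V) (v : V) : nat := #|[set w | e v w]|.

Definition edge_disjoint (e f : rel V) : Prop :=
  forall x y : V, ~~ (e x y && f x y).

End Graph.

Definition edge_disjoint_tree_realizations (k n : nat)
    (D : 'I_k -> 'I_n -> nat) (T : 'I_k -> rel 'I_n) : Prop :=
  [/\ forall i, is_tree (T i),
      forall i v, degree (T i) v = D i v
    & forall i j, i != j -> edge_disjoint (T i) (T j)].

Definition has_edge_disjoint_tree_realizations (k n : nat)
    (D : 'I_k -> 'I_n -> nat) : Prop :=
  exists T : 'I_k -> rel 'I_n, edge_disjoint_tree_realizations D T.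

(* Main.v *)
Require Import Defs.
From mathcomp Require Import all_boot zify.

Set Implicit Arguments.
Unset Strict Implicit.
Unset Printing Implicit Defensive.

(* Induction on the number of vertices. Total degrees average less than [2 k]
   per vertex, while without common leaves each is at least [2 k - 1]; hence at
   least [2 k] "low" vertices are a leaf of one tree [i] and have degree 2 in
   all the others. Delete such a vertex [v], lowering by one the [i]-th degree
   of a suitable [w], and realize what remains. Then [v] is put back by hanging
   it on [w] in tree [i] and by subdividing an edge of every other tree. The new
   edges are disjoint as soon as the subdivided edges form a matching that
   avoids [w]; with at least [4 k - 2] vertices left, such a matching is found
   greedily. *)

(** * Adding a vertex to a graph *)

Section VertexExtension.

Variables (n : nat) (h : 'I_n.+1).

(* [N] is the neighbourhood of the new vertex [h]. *)
Definition extend (e : rel 'I_n) (N : pred 'I_n) : rel 'I_n.+1 :=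
  fun a b => match unlift h a, unlift h b with
    | Some x, Some y => e x y
    | Some x, None | None, Some x => N x
    | None, None => false
    end.

Lemma extend_lift e N x y : extend e N (lift h x) (lift h y) = e x y.
Proof. by rewrite /extend !liftK. Qed.

Lemma extend_newl e N x : extend e N h (lift h x) = N x.
Proof. by rewrite /extend liftK unlift_none. Qed.

Lemma extend_newr e N x : extend e N (lift h x) h = N x.
Proof. by rewrite /extend liftK unlift_none. Qed.

Lemma extend_new e N : extend e N h h = false.
Proof. by rewrite /extend unlift_none. Qed.

Definition extendE := (extend_lift, extend_newl, extend_newr, extend_new).

Lemma extend_simple e N : simple_graph e -> simple_graph (extend e N).
Proof.
case=> esym eirr; split.
  move=> a b; case: (unliftP h a) => [x|] ->; case: (unliftP h b) => [y|] ->;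
    by rewrite !extendE // esym.
by move=> a; case: (unliftP h a) => [x|] ->; rewrite !extendE.
Qed.

Lemma extend_disjoint e f N M :
  edge_disjoint e f -> (forall x, ~~ (N x && M x)) ->
  edge_disjoint (extend e N) (extend f M).
Proof.
move=> ef NM a b; case: (unliftP h a) => [x|] ->;
  by case: (unliftP h b) => [y|] ->; rewrite !extendE.
Qed.

Lemma degree_extend_new e N : degree (extend e N) h = #|N|.
Proof.
rewrite /degree -sum1dep_card -sum1_card [LHS]big_mkcond (bigD1_ord h) //=.
rewrite extend_new add0n [RHS]big_mkcond /=.
by apply: eq_bigr => x _; rewrite extend_newl unfold_in.
Qed.

Lemma degree_extend_lift e N x :
  degree (extend e N) (lift h x) = N x + degree e x.
Proof.
rewrite /degree -!sum1dep_card [LHS]big_mkcond (bigD1_ord h) //= extend_newr.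
rewrite [in RHS]big_mkcond /=; congr (_ + _).
by apply: eq_bigr => y _; rewrite extend_lift.
Qed.

(** [e0] may lack edges of the connected graph [e], provided each is bypassed in the extension; this
    serves both for a pendant vertex and for a subdivided edge. *)
Lemma extend_connected (e e0 : rel 'I_n) (N : pred 'I_n) z :
  symmetric e0 -> connected_graph e -> N z ->
  (forall x y, e x y -> connect (extend e0 N) (lift h x) (lift h y)) ->
  connected_graph (extend e0 N).
Proof.
move=> esym [_ econ] Nz sub; split; first by rewrite card_ord.
have con x y : connect (extend e0 N) (lift h x) (lift h y).
  have /connectP[p + ->] := econ x y.
  elim: p x => [|a p IHp] x //= /andP[/sub xa /IHp]; exact: connect_trans.
have hz : connect (extend e0 N) h (lift h z).
  by apply: connect1; rewrite extend_newl.
have zh : connect (extend e0 N) (lift h z) h.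
  by apply: connect1; rewrite extend_newr.
move=> a b; case: (unliftP h a) => [x|] ->; case: (unliftP h b) => [y|] -> //.
- exact: connect_trans (con x z) zh.
- exact: connect_trans hz (con z y).
Qed.

Lemma map_lift_unlift (s : seq 'I_n.+1) :
  h \notin s -> exists s0, s = map (lift h) s0.
Proof.
elim: s => [|a s IHs]; first by exists [::].
rewrite inE negb_or => /andP[ha /IHs[s0 ->]].
by case: (unlift_some ha) => x -> _; exists (x :: s0).
Qed.

(** A cycle avoiding [h] lies in [e]. One through [h], rotated to start there, leaves a path of [e]
    between neighbours of [h]; if that path is a single vertex, the cycle is too short. *)
Lemma extend_acyclic (e : rel 'I_n) (N : pred 'I_n) :
  acyclic_graph e ->
  (forall x p, path e x p -> uniq (x :: p) -> N x -> N (last x p) ->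
     p = [::]) ->
  acyclic_graph (extend e N).
Proof.
move=> eacyc Npath c c3 /andP[cyc_c uniq_c].
have path_lift x p :
    path (extend e N) (lift h x) (map (lift h) p) = path e x p.
  by rewrite path_map; apply: eq_path => a b; rewrite /= extend_lift.
case: (boolP (h \in c)) => [hc|/map_lift_unlift[s defc]].
  case: (rot_to hc) => m s defs.
  move: cyc_c uniq_c c3.
  rewrite -(rot_cycle m) -(rot_uniq m) -(size_rot m) defs => {hc defs}.
  rewrite /= rcons_path => /andP[ph lh] /andP[/map_lift_unlift[p def_s]].
  rewrite {}def_s in ph lh *.
  rewrite map_inj_uniq; last exact: lift_inj.
  case: p ph lh => [|x p] //=.
  rewrite extend_newl path_lift last_map extend_newr => /andP[Nx px] Nl up.
  by rewrite (Npath x p).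
rewrite {}defc in c3 cyc_c uniq_c.
apply: (eacyc s); first by rewrite size_map in c3.
rewrite /ucycle -(map_inj_uniq (@lift_inj _ h)) uniq_c andbT.
case: s cyc_c {c3 uniq_c} => [|x s] //=.
by rewrite -map_rcons path_lift.
Qed.

Lemma add_leaf_tree (e : rel 'I_n) w :
  is_tree e -> is_tree (extend e (pred1 w)).
Proof.
case=> esimple econ eacyc; split.
- exact: extend_simple.
- apply: (extend_connected (e := e) (z := w)) => //=; first by case: esimple.
  by move=> x y exy; apply: connect1; rewrite extend_lift.
apply: extend_acyclic => // x [|a p] //= _ /andP[xp _] /eqP xw /eqP lw.
by rewrite xw -lw mem_last in xp.
Qed.

(** * Subdividing an edge of a tree *)

Definition remove_edge (e : rel 'I_n) (x y : 'I_n) : rel 'I_n :=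
  fun a b => e a b && ~~ ((a == x) && (b == y) || (a == y) && (b == x)).

Lemma remove_edge_simple e x y : simple_graph e -> simple_graph (remove_edge e x y).
Proof.
case=> esym eirr; split=> [a b|a]; rewrite /remove_edge ?eirr //.
by rewrite esym orbC; congr (_ && ~~ (_ || _)); rewrite andbC.
Qed.

(** The term [pred2 x y a] is exactly what the new vertex of a subdivision gives back, so
    subdividing preserves all old degrees. *)
Lemma degree_remove_edge e x y a : simple_graph e -> e x y ->
  pred2 x y a + degree (remove_edge e x y) a = degree e a.
Proof.
move=> [esym eirr] exy; have nxy : x != y.
  by apply: contraTneq exy => ->; rewrite eirr.
have end_deg u v :
    e u v -> u != v -> 1 + degree (remove_edge e u v) u = degree e u.
  move=> euv nuv; rewrite /degree [in RHS](cardsD1 v) inE euv; congr (_ + _).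
  by apply: eq_card => b; rewrite !inE /remove_edge eqxx (negbTE nuv) orbF andbC.
rewrite /=; case: (eqVneq a x) => [->|nax] /=.
  exact: end_deg.
case: (eqVneq a y) => [->|nay] /=.
  rewrite -(end_deg y x) //; [|by rewrite esym|by rewrite eq_sym].
  by congr (_ + _); apply: eq_card => b; rewrite !inE /remove_edge orbC.
rewrite add0n; apply: eq_card => b.
by rewrite !inE /remove_edge (negbTE nax) (negbTE nay) andbT.
Qed.

Lemma subdivide_edge_tree (e : rel 'I_n) x y :
  is_tree e -> e x y -> is_tree (extend (remove_edge e x y) (pred2 x y)).
Proof.
case=> esimple econ eacyc exy; have [esym eirr] := esimple.
have re_simple := remove_edge_simple x y esimple.
split; first exact: extend_simple.
  apply: (extend_connected (e := e) (z := x)) => //.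
  - by case: re_simple.
  - by rewrite /= eqxx.
  have xy_con a b : pred2 x y a -> pred2 x y b ->
      connect (extend (remove_edge e x y) (pred2 x y)) (lift h a) (lift h b).
    move=> Na Nb; apply: (@connect_trans _ _ h); apply: connect1.
      by rewrite extend_newr.
    by rewrite extend_newl.
  move=> a b eab; case: (boolP (remove_edge e x y a b)) => [re_ab|].
    by apply: connect1; rewrite extend_lift.
  rewrite /remove_edge eab negbK /= => /orP[]/andP[/eqP-> /eqP->];
  by apply: xy_con; rewrite /= eqxx ?orbT.
apply: extend_acyclic.
  move=> c c3 /andP[cyc_c uc]; apply: (eacyc c c3); rewrite /ucycle uc andbT.
  by apply: sub_cycle cyc_c => a b /andP[].
move=> a p pa ua Na Nl; case: p pa ua Nl => [|b p] //= pa ua Nl.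
have nla : last b p != a.
  by apply: contraTneq ua => {1}<-; rewrite mem_last.
have ela : e (last b p) a && ~~ remove_edge e x y a (last b p).
  case/orP: Na Nl nla => /eqP-> /orP[]/eqP->; rewrite ?eqxx //= => _.
    by rewrite esym exy /remove_edge !eqxx andbF.
  by rewrite exy /remove_edge !eqxx orbT andbF.
case/andP: ela => ela nrla.
(* The path joins the two ends of the removed edge, which closes it into a cycle of [e]. This cycle
   has at least three vertices because the path itself avoids that edge. *)
case: (eacyc [:: a, b & p]) => /=.
  case: p pa nrla {ua ela Nl nla} => [|d p] //=.
  by rewrite andbT => ->.
rewrite /ucycle /= ua andbT rcons_path ela andbT.
case/andP: pa => /andP[-> _] /= pb.
by apply: sub_path pb => u v /andP[].
Qed.

End VertexExtension.

(** * Leaf counts and degree sums *)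

Lemma card_set_sum (T : finType) (P : pred T) : #|[set x | P x]| = \sum_x P x.
Proof.
by rewrite -sum1dep_card big_mkcond; apply: eq_bigr => x _; case: (P x).
Qed.

Definition leaves n (d : 'I_n -> nat) : {set 'I_n} := [set v | d v == 1].

Lemma degseq_setC n (d : 'I_n -> nat) (S : {set 'I_n}) :
  tree_degseq d -> \sum_(v in S) d v + \sum_(v in ~: S) d v + 2 = 2 * n.
Proof.
case=> _ <-; rewrite [in RHS](bigID (mem S)) /=; congr (_ + _ + 2).
by apply: eq_bigl => v; rewrite inE.
Qed.

(** Outside [S] every degree is at least 2 except at leaves, so the complement takes at least
    [2 * #|~: S| - #|leaves d|] of the total [2 * n - 2]. *)
Lemma degseq_leaves n (d : 'I_n -> nat) (S : {set 'I_n}) :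
  tree_degseq d -> 2 + \sum_(v in S) d v <= #|leaves d| + 2 * #|S|.
Proof.
move=> dtree; have [dpos _] := dtree.
have lb : 2 * #|~: S| <= \sum_(v in ~: S) d v + #|leaves d|.
  have -> : 2 * #|~: S| = \sum_(v in ~: S) 2 by rewrite sum_nat_const mulnC.
  have /leq_trans-> // : \sum_(v in ~: S) 2 <=
      \sum_(v in ~: S) d v + \sum_(v in ~: S) (d v == 1).
    rewrite -big_split; apply: leq_sum => v _ /=; have := dpos v; lia.
  rewrite leq_add2l -sum1dep_card big_mkcond [leqRHS]big_mkcond /=.
  by apply: leq_sum => v _; case: (v \in _); case: (d v == 1).
have := cardsC S; rewrite card_ord.
have := degseq_setC S dtree; lia.
Qed.

Lemma two_leaves n (d : 'I_n -> nat) : tree_degseq d -> 2 <= #|leaves d|.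
Proof. by move/(degseq_leaves set0); rewrite big_set0 cards0 addn0 muln0 addn0. Qed.

(** If all degrees were 1 or 2, their sum would be [2 * n] minus the number of leaves, which allows
    only two leaves. *)
Lemma exists_branch n (d : 'I_n -> nat) :
  tree_degseq d -> 2 < #|leaves d| -> exists v, 2 < d v.
Proof.
case=> dpos dsum L3.
case: (pickP (fun v => 2 < d v)) => [v|d2]; first by exists v.
have : \sum_(v < n) d v + #|leaves d| <= n * 2.
  rewrite card_set_sum -big_split -[X in X * _]card_ord -sum_nat_const /=.
  by apply: leq_sum => v _; have := dpos v; have := d2 v; lia.
lia.
Qed.

Lemma leaf_at_most_once k n (D : 'I_k -> 'I_n -> nat) v :
  no_common_leaves D -> \sum_i (D i v == 1) <= 1.
Proof.
move=> ncl; case: (pickP (fun i => D i v == 1)) => [i /eqP Div|none].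
  rewrite (bigD1 i) //= big1 ?Div // => j ji.
  by have := ncl v i j Div ji; case: (D j v) => [|[|]].
by rewrite big1 // => i _; rewrite none.
Qed.

Lemma sum_leaves k n (D : 'I_k -> 'I_n -> nat) :
  no_common_leaves D -> \sum_i #|leaves (D i)| <= n.
Proof.
move=> ncl.
rewrite (eq_bigr (fun i => \sum_(v < n) (D i v == 1))); last first.
  by move=> i _; apply: card_set_sum.
rewrite exchange_big /= -[leqRHS]mul1n -[X in _ <= _ * X]card_ord mulnC -sum_nat_const.
by apply: leq_sum => v _; apply: leaf_at_most_once.
Qed.

(* If every edge of [e] met [S], the degrees over [S] would sum to at least
   [n - 1], which forces many leaves. *)
Lemma edge_avoiding n (e : rel 'I_n) (d : 'I_n -> nat) (S : {set 'I_n}) :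
  symmetric e -> (forall v, degree e v = d v) -> tree_degseq d ->
  #|leaves d| + 2 * #|S| <= n ->
  exists x y, [/\ e x y, x \notin S & y \notin S].
Proof.
move=> esym deg dtree Lsmall.
case: (pickP (fun p : 'I_n * 'I_n =>
  [&& e p.1 p.2, p.1 \notin S & p.2 \notin S])) => [[x y] /and3P[]|none].
  by exists x, y.
have := degseq_leaves S dtree.
(* No edge has both ends outside [S], so each edge counted on the left is counted on the right at
   its end in [S]. *)
have : \sum_(v in ~: S) d v <= \sum_(v in S) d v.
  have dE A : \sum_(v in A) d v = \sum_(v in A) \sum_(u < n) e v u.
    by apply: eq_bigr => v _; rewrite -deg /degree card_set_sum.
  rewrite !dE [leqRHS]exchange_big [leqRHS](bigID (mem (~: S))) /=.
  apply: leq_trans (leq_addr _ _); apply: leq_sum => v vS.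
  rewrite [leqRHS]big_mkcond; apply: leq_sum => u _.
  have := none (v, u); rewrite /= (esym u v); rewrite inE in vS; rewrite vS /=.
  by case: (e v u); case: (u \in S).
have := degseq_setC S dtree; lia.
Qed.

(** * Greedy choice of a rainbow matching *)

Lemma card_bigcup_leq (I T : finType) (P : pred I) (F : I -> {set T}) (f : I -> nat) :
  (forall i, P i -> #|F i| <= f i) -> #|\bigcup_(i | P i) F i| <= \sum_(i | P i) f i.
Proof.
move=> Ff; apply: (big_ind2 (fun (A : {set T}) m => #|A| <= m)) => //.
  by rewrite cards0.
move=> A m B p Am Bp; apply: leq_trans (leq_add Am Bp).
by rewrite cardsU leq_subr.
Qed.

Definition ends n (p : 'I_n * 'I_n) : {set 'I_n} := [set p.1; p.2].

Lemma card_ends n (p : 'I_n * 'I_n) : #|ends p| <= 2.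
Proof. by rewrite /ends cards2; case: (_ != _). Qed.

(** [A] stands for the trees already treated, [b] for the next one, [i] for the one never treated.
    The trees of [A] and [b] have at least [L b] leaves each, the others at least 2, within a total
    of [n]. This bounds [L b] well enough for [edge_avoiding] to dodge [2 * #|A| + 1] vertices. *)
Lemma rainbow_matching_card k n (L : 'I_k -> nat) (A : {set 'I_k}) (b i : 'I_k) :
  4 * k - 2 <= n -> \sum_j L j <= n -> (forall j, 2 <= L j) ->
  i \notin A -> b \notin A -> b != i -> (forall a, a \in A -> L b <= L a) ->
  L b + 2 * (2 * #|A| + 1) <= n.
Proof.
move=> n_ge sumL L2 iA bA bi Lmax.
have cA : #|A| + 2 <= k.
  have := subset_leq_card (subsetT (b |: (i |: A))).
  by rewrite !cardsU1 !inE (negbTE bi) iA bA cardsT card_ord addn2.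
have : (#|A| + 1) * L b + 2 * (k - #|A| - 1) <= \sum_j L j.
  have cAb : #|b |: A| = #|A| + 1 by rewrite cardsU1 bA addnC.
  rewrite (bigID (mem (b |: A))) /=; apply: leq_add.
    rewrite -cAb -sum_nat_const; apply: leq_sum => j; rewrite !inE.
    by case/orP=> [/eqP->|/Lmax].
  have -> : 2 * (k - #|A| - 1) = \sum_(j | j \notin b |: A) 2.
    rewrite sum_nat_const mulnC -subnDA -cAb -[X in X - _]card_ord.
    by rewrite -(cardC (b |: A)) addKn.
  exact: leq_sum.
have [le|gt] := leqP (L b + 2 * (2 * #|A| + 1)) n => //.
move=> sumL'; have {}sumL' := leq_trans sumL' sumL.
move: #|A| (L b) cA gt sumL' => m l; clear - n_ge => cA gt sumL.
(* By [gt], [l] is at least [n - 4 * m - 1]. Since [m + 2 <= k] and [4 * k - 2 <= n], the left side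
   in fact exceeds [n] by at least [m + 1]. *)
have : (m + 1) * (n - 4 * m - 1) + 2 * (k - m - 1) <= n.
  apply: leq_trans sumL; rewrite leq_add2r leq_mul2l; apply/orP; right; lia.
nia.
Qed.

(* Greedily, trees with the most leaves first: since the leaves of all the
   trees number at most [n], a tree treated late has many edges to spare. *)
Lemma rainbow_matching k n (D : 'I_k -> 'I_n -> nat) (T : 'I_k -> rel 'I_n) i w :
  4 * k - 2 <= n -> (forall j, tree_degseq (D j)) -> no_common_leaves D ->
  (forall j, symmetric (T j)) -> (forall j v, degree (T j) v = D j v) ->
  exists E : 'I_k -> 'I_n * 'I_n,
    [/\ forall j, j != i -> T j (E j).1 (E j).2,
        forall j, j != i -> w \notin ends (E j)
      & forall j l, j != i -> l != i -> j != l ->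
          [disjoint ends (E j) & ends (E l)]].
Proof.
move=> n_ge Dtree ncl Tsym Tdeg; pose L j := #|leaves (D j)|.
(* [A] holds [m] treated trees, none with fewer leaves than an untreated tree other than [i]. The
   values of [E] outside [A] are arbitrary. *)
have greedy m : m < k -> exists A : {set 'I_k}, exists E : 'I_k -> 'I_n * 'I_n,
    [/\ #|A| = m /\ i \notin A,
        forall a b, a \in A -> b \notin A -> b != i -> L b <= L a,
        forall j, j \in A -> T j (E j).1 (E j).2,
        forall j, j \in A -> w \notin ends (E j)
      & forall j l, j \in A -> l \in A -> j != l ->
          [disjoint ends (E j) & ends (E l)]].
  elim: m => [_|m IHm mk].
    exists set0, (fun _ => (w, w)).
    by split=> [|a b|j|j|j l]; rewrite ?cards0 ?inE.
  have [A [E [[cA iA] Amax AT Aw Adisj]]] := IHm (ltnW mk).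
  have [b0 b0P] : exists b0, (b0 != i) && (b0 \notin A).
    apply/existsP; apply: contraLR mk => /existsPn none.
    have : #|[set: 'I_k]| <= #|i |: A|.
      apply: subset_leq_card; apply/subsetP => j _; rewrite !inE.
      by have := none j; case: eqP; case: (j \in A).
    by rewrite cardsT card_ord cardsU1 iA cA -leqNgt.
  case: (@arg_maxnP _ b0 (fun b => (b != i) && (b \notin A)) L b0P) => b /andP[bi bA] bmax.
  pose S := w |: \bigcup_(j in A) ends (E j).
  have cS : #|S| <= 2 * #|A| + 1.
    rewrite /S cardsU1 addnC leq_add //; last by case: (_ \notin _).
    rewrite mulnC -sum_nat_const.
    by apply: card_bigcup_leq => j _; apply: card_ends.
  have Lb : L b + 2 * (2 * #|A| + 1) <= n.
    apply: (rainbow_matching_card (i := i) n_ge (sum_leaves ncl)) => //.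
      by move=> j; apply: two_leaves.
    by move=> a aA; apply: Amax.
  have [|x [y [Txy xS yS]]] := edge_avoiding (S := S) (Tsym b) (Tdeg b) (Dtree b).
    by apply: leq_trans Lb; rewrite leq_add2l leq_mul2l cS orbT.
  have newdisj j : j \in A -> [disjoint [set x; y] & ends (E j)].
    move=> jA; rewrite disjoint_subset; apply/subsetP => z.
    rewrite in_set2 => zxy; have : z \notin S by case/orP: zxy => /eqP->.
    by apply: contra => zE; rewrite inE; apply/orP; right; apply/bigcupP; exists j.
  exists (b |: A), (fun j => if j == b then (x, y) else E j); split.
  - by rewrite cardsU1 bA cA !inE negb_or eq_sym bi.
  - move=> a c; rewrite !inE negb_or => aA /andP[cb cA'] ci.
    case/orP: aA => [/eqP->|aA]; last exact: Amax.
    by apply: bmax; rewrite ci.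
  - by move=> j; rewrite !inE; case: eqP => [->|_ /AT].
  - move=> j; rewrite in_setU1; case: eqP => [_ _|_ /Aw //].
    by rewrite /ends !inE negb_or; apply/andP; split;
      [apply: contraNneq xS|apply: contraNneq yS] => /= <-; apply: setU11.
  - move=> j l; rewrite !in_setU1; case: eqP => [->|_] /=; case: eqP => [->|_] //=.
    + by rewrite eqxx.
    + by move=> _ lA _; apply: newdisj.
    + by move=> jA _ _; rewrite disjoint_sym; apply: newdisj.
    + exact: Adisj.
have k_gt0 : 0 < k := leq_ltn_trans (leq0n i) (ltn_ord i).
(* With [k.-1] trees treated, only [i] is left out. *)
have k1_lt : k.-1 < k by rewrite prednK.
have [A [E [[cA iA] _ AT Aw Adisj]]] := greedy _ k1_lt.
have inA j : j != i -> j \in A.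
  move=> ji; apply: contraT => jA.
  have := subset_leq_card (subsetT (j |: (i |: A))).
  by rewrite !cardsU1 !inE (negbTE ji) iA jA cardsT card_ord cA !add1n prednK // ltnn.
by exists E; split=> [j /inA /AT|j /inA /Aw|j l /inA jA /inA lA]; last exact: Adisj.
Qed.

(** * Low vertices and the choice of a deletion *)

Lemma sum_indicator1 (I : finType) (i : I) : \sum_j (j == i) = 1.
Proof. by rewrite (bigD1 i) //= eqxx big1 // => j /negbTE->. Qed.

Definition low_vertices k n (D : 'I_k -> 'I_n -> nat) : {set 'I_n} :=
  [set v | \sum_i D i v < 2 * k].

Lemma card_low_vertices k n (D : 'I_k -> 'I_n -> nat) :
  (forall i, tree_degseq (D i)) -> no_common_leaves D ->
  2 * k <= #|low_vertices D|.
Proof.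
move=> Dtree ncl.
have two_k : \sum_(i < k) 2 = 2 * k by rewrite sum_nat_const card_ord mulnC.
have tot : \sum_(v < n) \sum_i D i v + 2 * k = n * (2 * k).
  rewrite exchange_big /= -[in LHS]two_k -big_split /=.
  rewrite (eq_bigr (fun => 2 * n)); last by move=> i _; case: (Dtree i).
  by rewrite sum_nat_const card_ord; lia.
rewrite -(leq_add2l (\sum_(v < n) \sum_i D i v)) tot.
rewrite card_set_sum -big_split /= -[X in X * _]card_ord -sum_nat_const.
apply: leq_sum => v _; case: (ltnP (\sum_i D i v)) => [_|]; last by rewrite addn0.
rewrite -two_k.
apply: leq_trans (_ : \sum_i D i v + \sum_i (D i v == 1) <= _).
  rewrite -big_split; apply: leq_sum => i _ /=.
  by have := (Dtree i).1 v; lia.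
by rewrite leq_add2l leaf_at_most_once.
Qed.

(** A vertex that is nowhere a leaf totals at least [2 * k]. A leaf already totals at least
    [2 * k - 1], so a degree 3 in another tree would be one unit too many. *)
Lemma low_vertexP k n (D : 'I_k -> 'I_n -> nat) v :
  (forall i, tree_degseq (D i)) -> no_common_leaves D -> v \in low_vertices D ->
  exists2 i, D i v = 1 & forall j, j != i -> D j v = 2.
Proof.
move=> Dtree ncl; rewrite inE.
have two_k : \sum_(i < k) 2 = 2 * k by rewrite sum_nat_const card_ord mulnC.
case: (pickP (fun i => D i v == 1)) => [i /eqP Div|none] low; last first.
  suff : 2 * k <= \sum_i D i v by rewrite leqNgt low.
  rewrite -two_k; apply: leq_sum => i _.
  by have := none i; have := (Dtree i).1 v; lia.
exists i => // j ji; have Djv := ncl v i j Div ji.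
apply/eqP; rewrite eqn_leq Djv andbT leqNgt; apply/negP => Djv3.
(* The indicator of [i] makes up for the leaf, that of [j] records the excess; the two cancel on
   summation. *)
suff : \sum_l (2 + (l == j)) <= \sum_l (D l v + (l == i)).
  by rewrite !big_split /= !sum_indicator1 two_k leq_add2r leqNgt low.
apply: leq_sum => l _; case: (eqVneq l i) => [->|li].
  by rewrite Div eq_sym (negbTE ji).
by have := ncl v i l Div li; case: eqP => [->|_]; lia.
Qed.

(** The final disjunction lets the degree of [w] drop without creating a common leaf. If a low
    vertex is a leaf of a tree with more than two leaves, a branch vertex of that tree serves as
    [w]. Otherwise all trees turn out to be paths, and some vertex is a leaf of none. *)
Lemma exists_deletion k n (D : 'I_k -> 'I_n -> nat) :
  0 < k -> 2 * k < n -> (forall i, tree_degseq (D i)) -> no_common_leaves D ->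
  exists v i w, [/\ D i v = 1, forall j, j != i -> D j v = 2, 1 < D i w
    & 2 < D i w \/ forall j, 1 < D j w].
Proof.
move=> k_gt0 kn Dtree ncl; have low_ge := card_low_vertices Dtree ncl.
case: (pickP (fun p : 'I_n * 'I_k =>
    [&& p.1 \in low_vertices D, D p.2 p.1 == 1 & 2 < #|leaves (D p.2)|])).
  move=> [v i] /= /and3P[vlow /eqP Div L3].
  have [w Diw] := exists_branch (Dtree i) L3.
  have [j Djv other] := low_vertexP Dtree ncl vlow.
  exists v, i, w; split=> //; [|exact: ltnW|by left].
  suff -> : i = j by [].
  by apply/eqP; apply: contraPT Div => /other->.
move=> none.
have low_paths : low_vertices D \subset
    \bigcup_(i | #|leaves (D i)| <= 2) leaves (D i).
  apply/subsetP => v vlow; have [i Div _] := low_vertexP Dtree ncl vlow.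
  apply/bigcupP; exists i; last by rewrite inE Div.
  by have := none (v, i); rewrite /= vlow Div /= ltnNge => /negbFE.
(* The low vertices, at least [2 * k] of them, are covered by leaf sets of size at most 2; so all
   [k] trees must contribute. *)
have paths i : #|leaves (D i)| <= 2.
  rewrite leqNgt; apply/negP => L3.
  have := leq_trans low_ge (subset_leq_card low_paths).
  have le := card_bigcup_leq (fun j (Lj : #|leaves (D j)| <= 2) => Lj).
  move/leq_trans => /(_ _ le).
  rewrite sum_nat_const mulnC leq_mul2r /= leqNgt => /negP[].
  rewrite -[ltnRHS]card_ord; apply: proper_card; apply/properP; split.
    exact: subset_predT.
  by exists i; rewrite // unfold_in -ltnNge.
have [v vlow] : exists v, v \in low_vertices D.
  by apply/set0Pn; rewrite -card_gt0; apply: leq_trans low_ge; rewrite muln_gt0.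
have [i Div other] := low_vertexP Dtree ncl vlow.
(* The trees now have at most [2 * k] leaves in all, fewer than [n]. *)
have [w w_notleaf] : exists w, w \notin \bigcup_i leaves (D i).
  apply/existsP; apply: contraLR kn => /existsPn all_leaves; rewrite -leqNgt.
  have := card_bigcup_leq (P := predT) (fun j _ => paths j).
  rewrite sum_nat_const card_ord mulnC; apply: leq_trans.
  rewrite -[leqLHS]card_ord; apply: subset_leq_card.
  by apply/subsetP => w _; have := all_leaves w; rewrite negbK.
have Dw j : 1 < D j w.
  rewrite ltn_neqAle (Dtree j).1 andbT eq_sym.
  by apply: contra w_notleaf => Djw; apply/bigcupP; exists j; rewrite ?inE.
by exists v, i, w; split=> //; right.
Qed.

(** * Deleting a vertex and putting it back *)

(** Only tree [i] is adjusted: elsewhere [v] will return by subdividing an edge, which changes no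
    other degree. The subtraction is exact when [D i (lift v w)] exceeds 1. *)
Definition delete_vertex k n (v : 'I_n.+1) (i : 'I_k) (w : 'I_n)
    (D : 'I_k -> 'I_n.+1 -> nat) : 'I_k -> 'I_n -> nat :=
  fun j x => D j (lift v x) - ((j == i) && (x == w)).

Section VertexDeletion.

Variables (k n : nat) (v : 'I_n.+1) (i : 'I_k) (w : 'I_n).
Variable D : 'I_k -> 'I_n.+1 -> nat.
Let D' := delete_vertex v i w D.

Lemma delete_vertex_no_common_leaves :
  no_common_leaves D -> 2 < D i (lift v w) \/ (forall j, 1 < D j (lift v w)) ->
  no_common_leaves D'.
Proof.
move=> ncl wP x a b; have := ncl (lift v x) a b; rewrite /D' /delete_vertex.
case: (eqVneq x w) => [->|_]; last by rewrite !andbF !subn0.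
case: (eqVneq a i) => [->|ai]; case: (eqVneq b i) => [->|bi] //=;
  rewrite ?subn0 //; case: wP => [w3|w2]; rewrite ?eqxx //; try lia.
by move=> _ Daw; have := w2 a; rewrite Daw.
Qed.

Hypotheses (Div : D i v = 1) (Djv : forall j, j != i -> D j v = 2).
Hypothesis Diw : 1 < D i (lift v w).

Lemma delete_vertexK j x :
  D' j x + ((j == i) && (x == w)) = D j (lift v x).
Proof.
rewrite /D' /delete_vertex subnK //.
case: eqP => [->|] //=; case: eqP => [->|] //=; exact: ltnW.
Qed.

(** The sum must drop by 2: tree [i] loses 1 at [v] and 1 at [w], every other tree loses 2 at
    [v]. *)
Lemma delete_vertex_degseq j :
  (forall l, tree_degseq (D l)) -> tree_degseq (D' j).
Proof.
move=> Dtree; have [Dpos Dsum] := Dtree j; split.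
  move=> x; rewrite /D' /delete_vertex; have := Dpos (lift v x).
  by case: eqP => [->|_] /=; [case: eqP => [->|_]|]; lia.
have : \sum_(x < n) D' j x + (j == i) = \sum_(x < n) D j (lift v x).
  under [RHS]eq_bigr => x _ do rewrite -delete_vertexK.
  rewrite big_split /=; congr (_ + _); case: (j == i) => /=; last by rewrite big1.
  by rewrite sum_indicator1.
move: Dsum; rewrite (bigD1_ord v) //=; case: (eqVneq j i) => [->|/Djv->].
  by rewrite Div; lia.
lia.
Qed.

Lemma realize_from_deletion :
  4 * k - 2 <= n -> (forall l, tree_degseq (D' l)) -> no_common_leaves D' ->
  has_edge_disjoint_tree_realizations D' ->
  has_edge_disjoint_tree_realizations D.
Proof.
move=> n_ge Dtree' ncl' [T [Ttree Tdeg Tdisj]].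
have Tsimple j : simple_graph (T j) by case: (Ttree j).
have Tsym j : symmetric (T j) by case: (Tsimple j).
have [E [ET Ew Edisj]] := rainbow_matching i w n_ge Dtree' ncl' Tsym Tdeg.
have endsE j : ends (E j) =i pred2 (E j).1 (E j).2 by move=> x; rewrite !inE.
pose N j : pred 'I_n := if j == i then pred1 w else pred2 (E j).1 (E j).2.
pose T0 j := if j == i then T j else remove_edge (T j) (E j).1 (E j).2.
exists (fun j => extend v (T0 j) (N j)); split.
- move=> j; rewrite /T0 /N; case: (eqVneq j i) => [_|ji].
    exact: add_leaf_tree.
  by apply: subdivide_edge_tree => //; apply: ET.
- move=> j x; case: (unliftP v x) => [y|] ->; last first.
    rewrite degree_extend_new /N; case: (eqVneq j i) => [->|ji].
      by rewrite card1 Div.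
    rewrite Djv // -(eq_card (endsE j)) /ends cards2.
    by rewrite (contraTneq _ (ET j ji)) // => ->; case: (Tsimple j) => _ ->.
  rewrite degree_extend_lift -delete_vertexK -Tdeg /N /T0.
  case: (eqVneq j i) => [_|ji] /=; first by rewrite addnC.
  by rewrite addn0 degree_remove_edge //; apply: ET.
- move=> j l jl; apply: extend_disjoint => [x y|x].
    have sub m : T0 m x y -> T m x y.
      by rewrite /T0; case: eqP => // _ /andP[].
    by apply: contra (Tdisj j l jl x y) => /andP[/sub-> /sub->].
  (* A new edge to [x] shared by two trees would put [x] on two matching edges, or make [w] an end
     of one. *)
  have NE m : m != i -> N m x = (x \in ends (E m)).
    by move=> mi; rewrite endsE /N (negbTE mi).
  have Nw m : m != i -> ~~ ((x == w) && N m x).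
    move=> mi; rewrite NE //; apply: contra (Ew m mi) => /andP[/eqP->] //.
  have Ni : N i x = (x == w) by rewrite /N eqxx.
  case: (eqVneq j i) jl => [->|ji]; case: (eqVneq l i) => [->|li] jl.
  + by [].
  + by rewrite Ni Nw.
  + by rewrite Ni andbC Nw.
  + rewrite !NE //; have := Edisj j l ji li jl.
    by rewrite disjoint_subset => /subsetP/(_ x) xD; apply/andP => -[/xD/negP].
Qed.

End VertexDeletion.

Theorem theorem5 (k : nat) (k_gt0 : 0 < k)
  (small_realizable : forall (n : nat) (D : 'I_k -> 'I_n -> nat),
     n <= 4 * k - 2 ->
     (forall i, tree_degseq (D i)) -> no_common_leaves D ->
     has_edge_disjoint_tree_realizations D) :
  forall (n : nat) (D : 'I_k -> 'I_n -> nat),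
    (forall i, tree_degseq (D i)) -> no_common_leaves D ->
    has_edge_disjoint_tree_realizations D.
Proof.
elim=> [|n IHn] D Dtree ncl; first exact: small_realizable.
have [n_le|n_gt] := leqP n.+1 (4 * k - 2); first exact: small_realizable.
(* Now [n] is at least [4 * k - 2], as the matching requires after deletion; since [k] is positive,
   this is at least [2 * k]. *)
have kn : 2 * k < n.+1 by lia.
have [v [i [w [Div Djv Diw wP]]]] := exists_deletion k_gt0 kn Dtree ncl.
(* The degrees in tree [i] show that [w] differs from [v]. *)
case: (unliftP v w) Diw wP => [u|] -> Diw wP; last by rewrite Div in Diw.
have Dtree' j := delete_vertex_degseq Div Djv Diw j Dtree.
have ncl' := delete_vertex_no_common_leaves ncl wP.
by apply: (realize_from_deletion Div Djv Diw) => //; apply: IHn.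
Qed.
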